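(* Let $n\geqslant 2$ be an integer, let $0<\varepsilon<\frac{1}{3600\,n^{11}}$, and let a group $\mathcal{G}$ of $n\times n$ unitary complex matrices have a weak $\varepsilon$-approximate fixed point $\xi\in\mathbb{C}^n$. Then there exists a common eigenvector $\eta$ of $\mathcal{G}$ such that $\|\xi-\eta\|^2<3600\,n^{11}\,\varepsilon$.
   Context: $\mathbb{C}^n$ carries the standard inner product and $\|\cdot\|$ is the Euclidean norm. For $0<\varepsilon<1$, a vector $\xi\in\mathbb{C}^n$ with $\|\xi\|=1$ is a weak $\varepsilon$-approximate fixed point of a matrix group $\mathcal{G}\subseteq M_n(\mathbb{C})$ if $|\langle G\xi,\xi\rangle|\geqslant 1-\varepsilon$ for all $G\in\mathcal{G}$. A common eigenvector of $\mathcal{G}$ is a vector $\eta$ with $\|\eta\|=1$ such that for every $G\in\mathcal{G}$ there is a scalar $\lambda\in\mathbb{C}$ with $G\eta=\lambda\eta$. *)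

(* Defs.v *)
From HB Require Import structures.
From mathcomp Require Export all_boot all_order all_algebra.
From mathcomp Require Export classical_sets reals complex.

Set Implicit Arguments.
Unset Strict Implicit.
Unset Printing Implicit Defensive.

Export Order.TTheory GRing.Theory Num.Theory.

#[global] Open Scope ring_scope.
#[global] Open Scope complex_scope.

(* Vectors are columns, so that a matrix A acts by A *m u, whereas [dotmx] takes
   rows. The inner product is linear in the first argument and conjugate-linear
   in the second: \sum_i u_i * (v_i)^*. *)
Definition cdot (C : numClosedFieldType) (n : nat) (u v : 'cV[C]_n) : C :=
  dotmx u^T v^T.

(* As with [`|_|], the values lie in the nonnegative reals of C. *)
Definition cnorm (C : numClosedFieldType) (n : nat) (u : 'cV[C]_n) : C :=
  sqrtC (cdot u u).

Definition matrix_group (K : fieldType) (n : nat) (G : set 'M[K]_n) : Prop :=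
  [/\ (forall A, G A -> A \in unitmx),
      G 1%:M,
      (forall A B, G A -> G B -> G (A *m B)) &
      (forall A, G A -> G (invmx A))].

(* The parameter eps is meant to satisfy 0 < eps < 1. *)
Definition weak_approx_fixed_point (R : realType) (n : nat) (eps : R)
    (G : set 'M[R[i]]_n) (xi : 'cV[R[i]]_n) : Prop :=
  cnorm xi = 1 /\ forall A, G A -> (1 - eps)%:C <= `|cdot (A *m xi) xi|.

Definition common_eigenvector (C : numClosedFieldType) (n : nat)
    (G : set 'M[C]_n) (eta : 'cV[C]_n) : Prop :=
  cnorm eta = 1 /\ forall A, G A -> exists lambda : C, A *m eta = lambda *: eta.

(* Main.v *)
From HB Require Import structures.
From mathcomp Require Import boolp.
From mathcomp Require Import ring lra.
Require Import Defs.

Set Implicit Arguments.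
Unset Strict Implicit.
Unset Printing Implicit Defensive.

(** Unit vectors that differ by a phase span the same line, so the hypothesis
    is best read on the rank one projection [P = xi *m xi^t*]: each conjugate
    [A P A^*] with [A] in [G] has matrix coefficient [|<A xi, xi>|^2] at [xi],
    which is at least [(1 - eps)^2 >= 1 - 2 eps].  Averaging these conjugates
    produces a matrix [Q] that commutes with [G], is positive semidefinite of
    trace 1, and still satisfies [<Q xi, xi> >= 1 - 2 eps]
    ([averaged_projection]).  The eigenvalues of [Q] are nonnegative with sum
    1, and [<Q xi, xi>] is their mean with weights given by the squared
    coordinates of [xi] in an eigenbasis.  Hence one eigenvalue is at least
    [1 - 2 eps > 1/2], it is simple because the others add up to at most
    [2 eps], and [xi] has squared coordinate at least [1 - 4 eps] along its
    eigenline ([dominant_weight]).  This line is invariant under all that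
    commutes with [Q], so under [G] ([common_eigenvector_of_commutant]).
    Choosing the unit vector [eta] on it with [<xi, eta> >= 0]
    ([phase_alignment]) gives [|xi - eta|^2 <= 8 eps], a bound independent of
    the dimension ([common_eigenvector_near]).

    [G] may be infinite and carries no measure here, so the average is built
    by hand ([mean_ergodic]).  A finite subset of [G] spans the same linear
    space as [G], hence has the same commutant; let [T X] be the mean of the
    conjugates of [X] by its elements.  The iterates of [T] are bounded, which
    forces the kernel and the image of [1 - T] to meet only in 0, so
    [P = u + (w - T w)] with [T u = u].  The Cesaro means
    [(P + T P + ... + T^m P) / (m + 1)] then differ from [u] by
    [(w - T^(m+1) w) / (m + 1)], which tends to 0, so [u] inherits all closed
    convex conditions shared by the conjugates of [P].  As [u] is a mean of
    matrices with its own Hilbert-Schmidt norm, strict convexity makes all of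
    them equal to [u]: it commutes with [G], and [Q = u]. *)

Open Scope sesquilinear_scope.

(** * Means and half-spaces *)

Definition mean (C : numFieldType) (V : lmodType C) (s : seq V) : V :=
  (size s)%:R^-1 *: \sum_(x <- s) x.

(** A substitute for convexity: uniform means of finite families suffice for
    both the averaging operator and its Cesaro means. *)
Definition mean_closed (C : numFieldType) (V : lmodType C) (S : V -> Prop) :=
  forall s : seq V, s != [::] -> (forall x, x \in s -> S x) -> S (mean s).

(** Transfers the closure of a set of scalars to its preimage under a linear
    form, so that half-spaces reduce to half-lines. *)
Lemma mean_closed_linear (C : numFieldType) (V : lmodType C) (phi : V -> C)
    (S : C -> Prop) :
  mean_closed (S : C^o -> Prop) -> linear_for *%R phi ->
  mean_closed (fun x => S (phi x)).
Proof.
move=> meanS lin s s_neq0 Ss; pose phiL : {linear V -> C | *%R} :=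
  HB.pack phi (GRing.isLinear.Build C V C *%R phi lin).
have := meanS [seq phiL x | x <- s].
rewrite /mean size_map big_map -linear_sum -[_ *: _]linearZ; apply.
  by rewrite -size_eq0 size_map size_eq0.
by move=> _ /mapP[x xs ->]; apply: Ss.
Qed.

Lemma mean_ge (C : numFieldType) (c : C) :
  mean_closed ((fun x => c <= x) : C^o -> Prop).
Proof.
move=> s; rewrite -size_eq0 -lt0n => s_gt0 cs.
rewrite /mean [_ *: _]mulrC ler_pdivlMr ?ltr0n // mulr_natr.
rewrite -iter_addr_0 -count_predT -big_const_seq big_seq.
by rewrite [leRHS]big_seq; apply: ler_sum => x /cs.
Qed.

Lemma mean_eq (C : numFieldType) (c : C) :
  mean_closed ((fun x => x = c) : C^o -> Prop).
Proof.
move=> s; rewrite -size_eq0 => s_neq0 sc.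
rewrite /mean big_seq (eq_bigr (fun=> c) sc) -big_seq big_const_seq count_predT.
by rewrite iter_addr_0 -(mulr_natl c) [_ *: _]mulKf ?pnatr_eq0.
Qed.

Lemma mean_norm_le (C : numFieldType) (b : C) :
  mean_closed ((fun x => `|x| <= b) : C^o -> Prop).
Proof.
move=> s; rewrite -size_eq0 -lt0n => s_gt0 sb.
rewrite /mean normrM normfV normr_nat mulrC.
rewrite ler_pdivrMr ?ltr0n // mulr_natr.
apply: le_trans (ler_norm_sum _ _ _) _.
rewrite -iter_addr_0 -count_predT -big_const_seq big_seq.
by rewrite [leRHS]big_seq; apply: ler_sum => x /sb.
Qed.

(** * Linear algebra behind the mean ergodic theorem *)

(** The hypothesis says that [lker (1 - f)] and [limg (1 - f)] meet trivially;
    by rank-nullity they are then complementary. *)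
Lemma ergodic_decomposition (K : fieldType) (V : vectType K) (f : 'End(V)) :
    (forall w, f (w - f w) = w - f w -> w - f w = 0) ->
  forall x, exists u w, f u = u /\ x = u + (w - f w).
Proof.
move=> ker_im x; pose g : 'End(V) := (\1 - f)%VF.
have gE w : g w = w - f w by rewrite add_lfunE opp_lfunE id_lfunE.
have capE : (limg g :&: lker g)%VS = 0%VS.
  apply/eqP; rewrite -subv0; apply/subvP => _ /memv_capP[/memv_imgP[w _ ->]].
  rewrite memv_ker memv0 [g (g w)]gE subr_eq0 => /eqP ggw.
  by rewrite gE ker_im // -gE -ggw.
have addE : (limg g + lker g)%VS = fullv.
  apply/eqP; rewrite eqEdim subvf /= dimv_disjoint_sum //.
  by rewrite -(limg_ker_dim g fullv) capfv addnC.
have /memv_addP[_ /memv_imgP[w _ ->] [u ku ->]] : x \in (limg g + lker g)%VS.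
  by rewrite addE memvf.
exists u, w; rewrite [g w + u]addrC gE; split=> //.
by move: ku; rewrite memv_ker gE subr_eq0 => /eqP.
Qed.

(** Take a family from [S] with a span of maximal dimension: adjoining one more
    element of [S] cannot enlarge it. *)
Lemma finite_spanning (K : fieldType) (V : vectType K) (S : V -> Prop) :
  exists s : seq V, (forall x, x \in s -> S x) /\
    forall x, S x -> x \in <<s>>%VS.
Proof.
pose dim_reached d := `[< exists2 s : seq V, (forall x, x \in s -> S x) &
  \dim <<s>> = d >].
have exd : exists d, dim_reached d.
  by exists 0%N; apply/asboolP; exists [::]; rewrite ?span_nil ?dimv0.
have led d : dim_reached d -> (d <= \dim {:V})%N.
  by move=> /asboolP[s _ <-]; apply/dimvS/subvf.
case: (ex_maxnP exd led) => d /asboolP[s Ss sd] dmax.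
exists s; split=> // x Sx.
have xsd : (\dim <<x :: s>> <= \dim <<s>>)%N.
  rewrite sd; apply: dmax; apply/asboolP; exists (x :: s) => // y.
  by rewrite inE => /predU1P[->|/Ss].
have /eqP -> : <<s>>%VS == <<x :: s>>%VS.
  rewrite eqEdim xsd andbT; apply/span_subvP => y ys.
  by rewrite memv_span // inE ys orbT.
by rewrite memv_span ?mem_head.
Qed.

(** * Limits with an explicit 1/m rate *)

Lemma le0_of_mul_nat_le (R : realType) (x b : R) :
  (forall m : nat, x * m.+1%:R <= b) -> x <= 0.
Proof.
move=> xb; case: (lerP x 0) => // x_gt0.
have b_ge0 : 0 <= b by apply: le_trans (xb 0%N); rewrite mulr1 ltW.
have /archi_boundP : 0 <= b / x by rewrite divr_ge0 // ltW.
set k := Num.bound _; rewrite ltr_pdivrMr // => bk.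
have := le_trans (xb k) (ltW bk); rewrite mulrC ler_pM2r // ler_nat ltnn //.
Qed.

Lemma eq0_of_norm_mul_nat_le (R : realType) (z b : R[i]) :
  (forall m : nat, `|z| * m.+1%:R <= b) -> z = 0.
Proof.
move=> zb; apply/eqP; rewrite -normr_le0.
have zE : (complex.Re `|z|)%:C = `|z| by rewrite RRe_real ?normr_real.
rewrite -zE lecR; apply: (@le0_of_mul_nat_le _ _ (complex.Re b)) => m.
have : (complex.Re `|z| * m.+1%:R)%:C <= b by rewrite rmorphM /= zE rmorph_nat.
by rewrite lecE => /andP[_].
Qed.

Definition entrywise_le (C : numDomainType) m n (X : 'M[C]_(m, n)) (b : C) :=
  forall i j, `|X i j| <= b.

(** The explicit rate [b / (m + 1)], which the Cesaro means provide, replaces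
    a topology on matrices. *)
Definition adherent (R : realType) n (S : 'M[R[i]]_n -> Prop) (u : 'M[R[i]]_n) :=
  exists b : R[i], forall m : nat,
    exists2 X, S X & entrywise_le (X - u) (b / m.+1%:R).

Definition lipschitz (C : numDomainType) m n (phi : 'M[C]_(m, n) -> C) :=
  exists2 K : C, 0 <= K &
    forall X Y b, entrywise_le (X - Y) b -> `|phi X - phi Y| <= K * b.

Lemma linear_lipschitz (C : numDomainType) m n (phi : 'M[C]_(m, n) -> C) :
  linear_for *%R phi -> lipschitz phi.
Proof.
move=> lin; pose phiL : {linear 'M[C]_(m, n) -> C | *%R} :=
  HB.pack phi (GRing.isLinear.Build C _ C *%R phi lin).
exists (\sum_i \sum_j `|phi (delta_mx i j)|).
  by rewrite !sumr_ge0 // => i _; rewrite sumr_ge0.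
move=> X Y b XYb; rewrite -[phi]/(phiL : _ -> _) -linearB.
rewrite [X - Y]matrix_sum_delta linear_sum mulr_suml.
apply: le_trans (ler_norm_sum _ _ _) _; apply: ler_sum => i _.
rewrite linear_sum mulr_suml.
apply: le_trans (ler_norm_sum _ _ _) _; apply: ler_sum => j _.
by rewrite linearZ normrM mulrC ler_wpM2l.
Qed.

(** The order on [R[i]] only compares numbers with equal imaginary parts, so two
    limits are taken: the imaginary part of [phi u] is that of [c], and its real
    part is at least that of [c]. *)
Lemma adherent_ge (R : realType) n (S : 'M[R[i]]_n -> Prop) u phi c :
    adherent S u -> lipschitz phi ->
  (forall X, S X -> c <= phi X) -> c <= phi u.
Proof.
move=> [b Sub] [K K_ge0 phiK] phi_ge.
have {Sub phiK} dist m : exists2 z : R[i], c <= z &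
    `|z - phi u| * m.+1%:R <= K * b.
  have [X SX Xu] := Sub m; exists (phi X); first exact: phi_ge.
  by rewrite -ler_pdivlMr ?ltr0n // -mulrA; apply: phiK.
have part_le0 x : (forall z : R[i], c <= z -> x%:C <= `|z - phi u|) -> x <= 0.
  move=> xle; apply: (@le0_of_mul_nat_le _ _ (complex.Re (K * b))) => m.
  have [z cz zb] := dist m.
  have : (x * m.+1%:R)%:C <= K * b.
    apply: le_trans zb; rewrite rmorphM /= rmorph_nat.
    by rewrite ler_pM2r ?ltr0n // xle.
  by rewrite lecE => /andP[_].
have norm_Im (z : R[i]) : `|complex.Im z|%:C <= `|z|.
  have := normc_ge_Re (z * 'i%C); rewrite ReiNIm normrN normrM.
  by rewrite complexiE normCi mulr1.
rewrite lecE; apply/andP; split.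
  rewrite -subr_eq0 -normr_le0; apply: part_le0 => z.
  rewrite [c <= z]lecE => /andP[/eqP <- _].
  rewrite -[`|_ - _|]normrN opprB -raddfB.
  exact: norm_Im.
rewrite -subr_le0; apply: part_le0 => z; rewrite [c <= z]lecE => /andP[_ cz].
apply: le_trans (normc_ge_Re _); rewrite lecR raddfB.
by apply: le_trans (ler_norm _); rewrite lerB.
Qed.

Lemma adherent_eq (R : realType) n (S : 'M[R[i]]_n -> Prop) u phi c :
    adherent S u -> lipschitz phi ->
  (forall X, S X -> phi X = c) -> phi u = c.
Proof.
move=> Su [K K_ge0 phiK] phi_eq.
have phi_lip : lipschitz phi by exists K.
have opp_lip : lipschitz (fun X => - phi X).
  by exists K => // X Y b /phiK; rewrite -opprD normrN.
apply/le_anti; rewrite -lerN2.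
rewrite (adherent_ge Su opp_lip) => [|X /phi_eq ->//].
by rewrite (adherent_ge Su phi_lip) // => X /phi_eq ->.
Qed.

(** * Strict convexity of the Hilbert-Schmidt norm *)

Section HilbertSchmidt.
Variables (C : numClosedFieldType) (n : nat).
Implicit Types X u : 'M[C]_n.

Lemma mxtrace_mul_adj X : \tr (X *m X^t*) = \sum_i \sum_j `|X i j| ^+ 2.
Proof.
apply: eq_bigr => i _; rewrite mxE; apply: eq_bigr => j _.
by rewrite !mxE normCK.
Qed.

Lemma mxtrace_mul_adj_ge0 X : 0 <= \tr (X *m X^t*).
Proof.
rewrite mxtrace_mul_adj; apply: sumr_ge0 => i _; apply: sumr_ge0 => j _.
by rewrite exprn_ge0.
Qed.

Lemma mxtrace_mul_adj_eq0 X : \tr (X *m X^t*) = 0 -> X = 0.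
Proof.
rewrite mxtrace_mul_adj => X0; apply/matrixP=> i j; rewrite mxE.
have row_ge0 k : 0 <= \sum_l `|X k l| ^+ 2.
  by apply: sumr_ge0 => l _; rewrite exprn_ge0.
have row0 := psumr_eq0P (fun k _ => row_ge0 k) X0 (i := i) isT.
have /eqP := psumr_eq0P (fun l _ => exprn_ge0 2 (normr_ge0 (X i l))) row0 (i := j) isT.
by rewrite sqrf_eq0 normr_eq0 => /eqP.
Qed.

(** If [u] is the mean of the [X], all of the same norm as [u], then the squared
    distances [|X - u|^2] add up to
    [2 N |u|^2 - <\sum X, u> - <u, \sum X> = 0]. *)
Lemma mean_eq_extremal u (s : seq 'M[C]_n) : s != [::] -> mean s = u ->
    (forall X, X \in s -> \tr (X *m X^t*) = \tr (u *m u^t*)) ->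
  forall X, X \in s -> X = u.
Proof.
rewrite -size_eq0 => s_neq0 su norm_s.
have sumE : \sum_(X <- s) X = (size s)%:R *: u.
  by rewrite -su scalerA mulfV ?scale1r // pnatr_eq0.
have /eqP : \sum_(X <- s) \tr ((X - u) *m (X - u)^t*) = 0.
  have distE X : X \in s -> \tr ((X - u) *m (X - u)^t*)
      = \tr (u *m u^t*) *+ 2 - \tr (X *m u^t*) - \tr (u *m X^t*).
    move=> /norm_s Xu.
    rewrite linearB /= map_mxB mulmxBl !mulmxBr !linearB /= Xu mulr2n; ring.
  rewrite big_seq (eq_bigr _ distE) -big_seq !sumrB.
  have -> : \sum_(X <- s) \tr (X *m u^t*) = \tr (u *m u^t*) *+ size s.
    by rewrite -linear_sum -mulmx_suml sumE -scalemxAl linearZ /= mulr_natl.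
  have -> : \sum_(X <- s) \tr (u *m X^t*) = \tr (u *m u^t*) *+ size s.
    rewrite -linear_sum -mulmx_sumr -map_mx_sum -linear_sum sumE linearZ /=.
    by rewrite map_mxZ /= rmorph_nat -scalemxAr linearZ /= mulr_natl.
  rewrite big_const_seq count_predT iter_addr_0 -mulrnA mulnC mulrnA; ring.
rewrite psumr_eq0 => [/allP s0 X Xs|X _]; last exact: mxtrace_mul_adj_ge0.
by apply/eqP; rewrite -subr_eq0; apply/eqP/mxtrace_mul_adj_eq0/eqP/(s0 X Xs).
Qed.

End HilbertSchmidt.

(** * Conjugation by unitary matrices *)

Section UnitaryConjugation.
Variables (C : numClosedFieldType) (n : nat).
Implicit Types A X : 'M[C]_n.

Definition conjmx_unitary A X := A *m X *m A^t*.

Lemma unitarymx_adj_mul A : A \is unitarymx -> A^t* *m A = 1%:M.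
Proof. by move=> uA; rewrite -invmx_unitary // mulVmx // unitarymx_unit. Qed.

Lemma conjmx_unitary_comp A B X :
  conjmx_unitary A (conjmx_unitary B X) = conjmx_unitary (A *m B) X.
Proof. by rewrite /conjmx_unitary trmx_mul map_mxM !mulmxA. Qed.

Lemma mxtrace_conjmx_unitary A X : A \is unitarymx ->
  \tr (conjmx_unitary A X) = \tr X.
Proof.
by move=> uA; rewrite /conjmx_unitary mxtrace_mulC mulmxA unitarymx_adj_mul ?mul1mx.
Qed.

Lemma adj_conjmx_unitary A X :
  (conjmx_unitary A X)^t* = conjmx_unitary A (X^t*).
Proof. by rewrite /conjmx_unitary !trmx_mul !map_mxM trmxCK mulmxA. Qed.

Lemma norm_conjmx_unitary A X : A \is unitarymx ->
  \tr (conjmx_unitary A X *m (conjmx_unitary A X)^t*) = \tr (X *m X^t*).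
Proof.
move=> uA; rewrite adj_conjmx_unitary -(mxtrace_conjmx_unitary (X *m _) uA).
by rewrite /conjmx_unitary !mulmxA mulmxKtV // -!mulmxA.
Qed.

Lemma conjmx_unitary_fixed A X : A \is unitarymx ->
  conjmx_unitary A X = X -> A *m X = X *m A.
Proof.
move=> uA {2}<-; rewrite /conjmx_unitary -[RHS]mulmxA unitarymx_adj_mul //.
by rewrite mulmx1.
Qed.

Lemma unitarymx_entry_le A i j : A \is unitarymx -> `|A i j| <= 1.
Proof.
move=> /unitarymxP/matrixP/(_ i i); rewrite !mxE eqxx mulr1n => AA.
rewrite -(@expr_le1 _ 2) // -AA (bigD1 j) //= !mxE -normCK lerDl.
by apply: sumr_ge0 => k _; rewrite !mxE -normCK exprn_ge0.
Qed.

(** A bound that does not depend on [A]: it makes the conjugates of a fixed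
    matrix, and hence their means, uniformly bounded. *)
Lemma conjmx_unitary_entry_le A X : A \is unitarymx ->
  entrywise_le (conjmx_unitary A X) (\sum_k \sum_l `|X k l|).
Proof.
move=> uA i j; rewrite /conjmx_unitary mxE exchange_big /=.
apply: le_trans (ler_norm_sum _ _ _) _; apply: ler_sum => l _.
rewrite normrM !mxE norm_conjC mulrC.
rewrite -[leRHS]mul1r; apply: ler_pM => //; first exact: unitarymx_entry_le.
apply: le_trans (ler_norm_sum _ _ _) _; apply: ler_sum => k _.
by rewrite normrM ler_piMl // unitarymx_entry_le.
Qed.

Lemma conjmx_unitary_entry_linear A i j :
  linear_for *%R (fun X => conjmx_unitary A X i j).
Proof.
move=> c X Y; rewrite /conjmx_unitary mulmxDr mulmxDl.
by rewrite -scalemxAr -scalemxAl !mxE.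
Qed.

Definition conjmx_unitary_fun A : 'End('M[C]_n) := linfun (mulmxr (A^t*) \o mulmx A).

Lemma conjmx_unitary_funE A X : conjmx_unitary_fun A X = conjmx_unitary A X.
Proof. by rewrite lfunE. Qed.

End UnitaryConjugation.

(** * The mean ergodic theorem for conjugation *)

Section MeanErgodic.
Variables (R : realType) (n : nat) (G : set 'M[R[i]]_n).
Hypotheses (groupG : matrix_group G)
           (unitaryG : forall A, G A -> A \is unitarymx).

Definition conj_invariant (S : 'M[R[i]]_n -> Prop) :=
  forall A X, G A -> S X -> S (conjmx_unitary A X).

(** The fixed point is an entrywise limit of Cesaro means, each of which lies in
    [S] because [S] contains all iterates [T^j P]. *)
Theorem mean_ergodic (S : 'M[R[i]]_n -> Prop) (P : 'M[R[i]]_n) :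
    mean_closed S -> conj_invariant S -> S P ->
  exists u, adherent S u /\ forall A, G A -> A *m u = u *m A.
Proof.
move=> meanS invS SP; have [_ G1 GM _] := groupG.
have [s0 [Gs0 spans0]] := finite_spanning G.
(* The identity keeps the family nonempty, so that its mean makes sense. *)
pose s := 1%:M :: s0.
have Gs A : A \in s -> G A by rewrite inE => /predU1P[->|/Gs0].
pose T : 'End('M[R[i]]_n) :=
  ((size s)%:R^-1 *: \sum_(A <- s) conjmx_unitary_fun A)%VF.
have TE X : T X = mean [seq conjmx_unitary A X | A <- s].
  rewrite /T scale_lfunE sum_lfunE /mean size_map big_map.
  by under [in LHS]eq_bigr do rewrite conjmx_unitary_funE.
have iterT S' X j : mean_closed S' -> conj_invariant S' -> S' X ->
    S' (iter j T X).
  move=> meanS' invS' S'X; elim: j => //= j IHj; rewrite TE; apply: meanS' => //.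
  by move=> _ /mapP[A /Gs GA ->]; apply: invS'.
have telescope u w k : T u = u ->
    \sum_(j < k) iter j T (u + (w - T w)) = u *+ k + (w - iter k T w).
  move=> Tu; elim: k => [|k IHk]; first by rewrite big_ord0 subrr addr0.
  rewrite big_ord_recr /= IHk mulrSr -!addrA; congr (_ + _).
  have -> : iter k T (u + (w - T w)) = u + (iter k T w - T (iter k T w)).
    elim: k {IHk} => //= k ->.
    by rewrite linearD linearB /= Tu.
  by rewrite [- _ + _]addrCA addKr addrCA.
have iter_bounded w : exists b, forall k, entrywise_le (w - iter k T w) b.
  pose b := \sum_k \sum_l `|w k l|.
  (* All conjugates are bounded at once, to make the condition invariant. *)
  pose S' X := forall A, G A -> entrywise_le (conjmx_unitary A X) b.
  have meanS' : mean_closed S'.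
    move=> r r0 rS A GA i j.
    apply: (mean_closed_linear (@mean_norm_le _ b)
      (conjmx_unitary_entry_linear A i j)) => // X rX.
    exact: rS.
  have invS' : conj_invariant S'.
    by move=> A X GA S'X B GB; rewrite conjmx_unitary_comp; apply/S'X/GM.
  have S'w : S' w by move=> A GA; apply/conjmx_unitary_entry_le/unitaryG.
  exists (b + b) => k i j; rewrite !mxE.
  have le_b X : S' X -> `|X i j| <= b.
    by move=> /(_ _ G1 i j); rewrite /conjmx_unitary mul1mx trmx1 map_mx1 mulmx1.
  by apply: le_trans (ler_normB _ _) _; rewrite lerD ?le_b //; exact: (iterT S').
(* A vector fixed by [T] equals its Cesaro means; for [w - T w] these are
   [(w - T^m w) / m], so they vanish in the limit. *)
have ker_im w : T (w - T w) = w - T w -> w - T w = 0.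
  move=> Tv; have [b wb] := iter_bounded w.
  have iter_v j : iter j T (w - T w) = w - T w by elim: j => //= j ->.
  apply/matrixP=> i j; rewrite [RHS]mxE; apply: (@eq0_of_norm_mul_nat_le _ _ b) => m.
  have := telescope 0 w m.+1 (linear0 _); rewrite add0r mul0rn add0r.
  under eq_bigr do rewrite iter_v.
  rewrite sumr_const card_ord => vE; have := wb m.+1 i j.
  by rewrite -vE mulmxnE normrMn mulr_natr.
have [u [w [Tu PE]]] := ergodic_decomposition ker_im P.
exists u; split.
  have [b wb] := iter_bounded w; exists b => m.
  exists (mean [seq iter j T P | j <- iota 0 m.+1]).
    by apply: (meanS _) => // _ /mapP[j _ ->]; apply: iterT.
  rewrite /mean size_map size_iota big_map -[iota _ _]/(index_iota 0 m.+1).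
  rewrite big_mkord PE telescope // scalerDr -scaler_nat scalerA mulVf ?pnatr_eq0 //.
  rewrite scale1r addrC addKr => i j; rewrite mxE normrM mulrC.
  by rewrite normfV normr_nat ler_wpM2r ?invr_ge0 ?ler0n ?wb.
(* [T u = u] says that [u] is the mean of its conjugates, which have its
   Hilbert-Schmidt norm. *)
have s_comm A : A \in s -> A *m u = u *m A.
  move=> As; apply: conjmx_unitary_fixed; first exact/unitaryG/Gs.
  apply: (@mean_eq_extremal _ _ u [seq conjmx_unitary B u | B <- s]) => //.
  - by rewrite -TE.
  - by move=> _ /mapP[B /Gs/unitaryG uB ->]; rewrite norm_conjmx_unitary.
  - by apply/mapP; exists A.
(* Commuting with [u] is a linear condition, so it passes from [s0] to its span. *)
pose commutator : 'Hom('M[R[i]]_n, 'M[R[i]]_n) := linfun (mulmxr u \- mulmx u).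
have comm_ker A : (A \in lker commutator) = (A *m u == u *m A).
  by rewrite memv_ker lfunE /= subr_eq0.
move=> A /spans0 As0; apply/eqP; rewrite -comm_ker; apply: subvP As0.
apply/span_subvP => B Bs0; rewrite comm_ker s_comm //.
by rewrite inE Bs0 orbT.
Qed.

End MeanErgodic.

(** * The inner product *)

Section InnerProduct.
Local Open Scope ring_scope.
Variables (C : numClosedFieldType) (n : nat).
Implicit Types (u v w : 'cV[C]_n) (A X : 'M[C]_n).

Lemma cdotE u v : cdot u v = \sum_i u i 0 * (v i 0)^*.
Proof.
by rewrite /cdot dotmxE mxE; apply: eq_bigr => i _; rewrite !mxE.
Qed.

Lemma cdot_mx u v : cdot u v = (v^t* *m u) 0 0.
Proof. by rewrite cdotE mxE; apply: eq_bigr => i _; rewrite !mxE mulrC. Qed.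

Lemma cdot_adj A u v : cdot (A *m u) v = cdot u (A^t* *m v).
Proof. by rewrite !cdot_mx trmx_mul map_mxM trmxCK mulmxA. Qed.

Lemma cdot_conj u v : cdot u v = (cdot v u)^*.
Proof.
rewrite !cdotE rmorph_sum; apply: eq_bigr => i _.
by rewrite rmorphM /= conjCK mulrC.
Qed.

Lemma cdot_delta u k : cdot u (delta_mx k 0) = u k 0.
Proof.
rewrite cdotE (bigD1 k) //= big1 => [|i /negPf ik]; rewrite mxE ?ik ?eqxx.
  by rewrite conjC1 mulr1 addr0.
by rewrite conjC0 mulr0.
Qed.

Lemma cdot_normE u : cdot u u = \sum_i `|u i 0| ^+ 2.
Proof. by rewrite cdotE; apply: eq_bigr => i _; rewrite normCK. Qed.

Lemma cdotBl u v w : cdot (u - v) w = cdot u w - cdot v w.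
Proof. by rewrite !cdot_mx mulmxBr !mxE. Qed.

Lemma cdotZl a u v : cdot (a *: u) v = a * cdot u v.
Proof. by rewrite !cdot_mx -scalemxAr !mxE. Qed.

Lemma cdotBr u v w : cdot u (v - w) = cdot u v - cdot u w.
Proof. by rewrite ![cdot u _]cdot_conj cdotBl rmorphB. Qed.

Lemma cdotZr a u v : cdot u (a *: v) = a^* * cdot u v.
Proof. by rewrite ![cdot u _]cdot_conj cdotZl rmorphM. Qed.

Lemma cnorm_sqr u : cnorm u ^+ 2 = cdot u u.
Proof. by rewrite /cnorm sqrtCK. Qed.

Lemma cnorm_eq1 u : cdot u u = 1 -> cnorm u = 1.
Proof. by rewrite /cnorm => ->; rewrite sqrtC1. Qed.

Lemma form_linear v w : linear_for *%R (fun X : 'M[C]_n => cdot (X *m v) w).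
Proof. by move=> a X Y; rewrite !cdot_mx mulmxDl mulmxDr -scalemxAl -scalemxAr !mxE. Qed.

Lemma form_rank1 u v w : cdot (u *m v^t* *m w) w = cdot w v * cdot u w.
Proof.
rewrite [cdot w v]cdot_mx !cdot_mx -mulmxA [v^t* *m w]mx11_scalar.
by rewrite mul_mx_scalar -scalemxAr !mxE eqxx mulr1n.
Qed.

Lemma form_conjmx_unitary A X v :
  cdot (conjmx_unitary A X *m v) v = cdot (X *m (A^t* *m v)) (A^t* *m v).
Proof. by rewrite /conjmx_unitary -!mulmxA cdot_adj. Qed.

(** With [w = <u, v>], the phase [z = w / |w|] makes [<u, z v> = |w|], so the
    squared distance is [2 - 2 |w|].  Since [c <= 1], the bound [c <= |w|^2]
    gives [c <= |w|]. *)
Lemma phase_alignment (c : C) u v :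
    cdot u u = 1 -> cdot v v = 1 -> 0 < c <= 1 -> c <= `|cdot u v| ^+ 2 ->
  exists2 z : C, `|z| = 1 & cdot (u - z *: v) (u - z *: v) <= 2 * (1 - c).
Proof.
move=> u1 v1 /andP[c_gt0 c_le1] cuv; set w := cdot u v in cuv.
have c_le : c <= `|w|.
  rewrite real_leNgt ?normr_real ?(gtr0_real c_gt0) //; apply/negP => wc.
  have := lt_le_trans wc cuv; rewrite expr2 le_gtF // ler_piMr //.
  exact/ltW/(lt_le_trans wc).
have w_neq0 : `|w| != 0 by rewrite gt_eqF // (lt_le_trans c_gt0).
exists (w / `|w|); first by rewrite normrM normfV normr_id mulfV.
have wz : (w / `|w|)^* * w = `|w|.
  rewrite rmorphM fmorphV /= conj_normC mulrAC [_^* * w]mulrC -normCK.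
  by rewrite expr2 mulfK.
have zw : w / `|w| * w^* = `|w|.
  by rewrite mulrAC -normCK expr2 mulfK.
have zz : (w / `|w|) * (w / `|w|)^* = 1.
  by rewrite -normCK normrM normfV normr_id mulfV ?expr1n.
rewrite cdotBl !cdotBr !cdotZl !cdotZr u1 v1 -/w wz [cdot v u]cdot_conj -/w zw.
rewrite mulr1 zz -subr_ge0.
have -> : 2 * (1 - c) - (1 - `|w| - (`|w| - 1)) = 2 * (`|w| - c) by ring.
by rewrite mulr_ge0 ?subr_ge0.
Qed.

End InnerProduct.

(** * A matrix of trace one with a nearly extremal vector *)

(** A weighted mean of the [d i] is at most their maximum, so some [d k] is at
    least [1 - t]; the others are then at most [t < 1/2].  Therefore
    [1 - t <= c k + t (1 - c k)], that is [(1 - t) (1 - c k) <= t], and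
    [1 - t >= 1/2]. *)
Lemma dominant_weight (F : numFieldType) n (d c : 'I_n -> F) (t : F) :
    (forall i, 0 <= d i) -> (forall i, 0 <= c i) ->
    \sum_i d i = 1 -> \sum_i c i = 1 -> 0 <= t -> 2 * t < 1 ->
    1 - t <= \sum_i d i * c i ->
  exists k, (forall i, i != k -> d i != d k) /\ 1 - c k <= 2 * t.
Proof.
move=> d_ge0 c_ge0 d1 c1 t_ge0 t_lt dc.
have t_lt' : t < 1 - t by rewrite -subr_gt0 (_ : _ - _ = 1 - 2 * t) ?subr_gt0 //; ring.
have t_real : t \is Num.real by rewrite ger0_real.
have [k dk] : exists k, 1 - t <= d k.
  apply/existsP; apply: contraPT dc => /existsPn dt.
  have {}dt i : d i < 1 - t.
    by rewrite real_ltNge ?dt // ?ger0_real // ltW // (le_lt_trans t_ge0).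
  rewrite -subr_ge0 => dc.
  have gap_ge0 i : 0 <= (1 - t - d i) * c i by rewrite mulr_ge0 ?subr_ge0 // ltW.
  (* Otherwise the nonnegative terms [(1 - t - d i) * c i] have a nonpositive
     sum, so they vanish and with them all the weights [c i]. *)
  have gap0 : \sum_i (1 - t - d i) * c i = 0.
    have gapE : \sum_i (1 - t - d i) * c i = 1 - t - \sum_i d i * c i.
      rewrite (eq_bigr (fun i => (1 - t) * c i - d i * c i)) => [|i _].
        by rewrite sumrB -mulr_sumr c1 mulr1.
      by rewrite mulrBl.
    by apply/le_anti; rewrite sumr_ge0 // andbT gapE -opprB oppr_le0.
  have c0 i : c i = 0.
    have /eqP := psumr_eq0P (fun i _ => gap_ge0 i) gap0 (i := i) isT.
    by rewrite mulf_eq0 subr_eq0 gt_eqF ?dt //= => /eqP.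
  by move: c1; rewrite big1 // => /eqP; rewrite eq_sym oner_eq0.
exists k; have d_le i : i != k -> d i <= t.
  move=> ik; move: d1; rewrite (bigD1 k) //= (bigD1 i) //= => d1.
  apply: (@le_trans _ _ (1 - d k)); last by rewrite lerBlDr -lerBlDl.
  by rewrite -d1 [d k + _]addrC addrK lerDl sumr_ge0.
have ck : c k = 1 - \sum_(i | i != k) c i.
  by rewrite -c1 [in RHS](bigD1 k) //= addrK.
have dk_le1 : d k <= 1 by rewrite -d1 (bigD1 k) //= lerDl sumr_ge0.
have ck_le1 : 0 <= 1 - c k by rewrite ck opprB addrC subrK sumr_ge0.
split=> [i /d_le di|]; first by rewrite lt_eqF // (le_lt_trans di) // (lt_le_trans t_lt').
have : 1 - t <= c k + t * (1 - c k).
  apply: le_trans dc _; rewrite (bigD1 k) //= lerD ?ler_piMl //.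
  rewrite ck opprB addrC subrK mulr_sumr; apply: ler_sum => i ik.
  by rewrite ler_wpM2r ?d_le.
rewrite -subr_ge0 => h; rewrite -subr_ge0.
have -> : 2 * t - (1 - c k)
    = 2 * (c k + t * (1 - c k) - (1 - t)) + (1 - 2 * t) * (1 - c k) by ring.
by rewrite addr_ge0 // mulr_ge0 // subr_ge0 ltW.
Qed.

Section SpectralGap.
Local Open Scope ring_scope.
Variables (C : numClosedFieldType) (n : nat).
Implicit Types (v xi eta : 'cV[C]_n) (A Q : 'M[C]_n).

Definition spectral_vector Q (k : 'I_n) : 'cV[C]_n :=
  (spectralmx Q)^t* *m delta_mx k 0.

Lemma spectral_decomposition Q : Q \is normalmx ->
  Q = (spectralmx Q)^t* *m diag_mx (spectral_diag Q) *m spectralmx Q.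
Proof.
by move=> /orthomx_spectralP; rewrite invmx_unitary ?spectral_unitarymx.
Qed.

Lemma spectral_vector_coord Q k :
  spectralmx Q *m spectral_vector Q k = delta_mx k 0.
Proof.
by rewrite mulmxA (unitarymxP (spectral_unitarymx Q)) mul1mx.
Qed.

Lemma form_spectral Q v : Q \is normalmx ->
  cdot (Q *m v) v =
  \sum_i spectral_diag Q 0 i * `|(spectralmx Q *m v) i 0| ^+ 2.
Proof.
move=> /spectral_decomposition QE; rewrite [in LHS]QE -!mulmxA cdot_adj trmxCK.
rewrite cdotE; apply: eq_bigr => i _.
by rewrite mul_diag_mx mxE -mulrA -normCK.
Qed.

Lemma form_spectral_vector Q k : Q \is normalmx ->
  cdot (Q *m spectral_vector Q k) (spectral_vector Q k) = spectral_diag Q 0 k.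
Proof.
move=> nQ; rewrite form_spectral // spectral_vector_coord (bigD1 k) //= big1.
  by rewrite mxE !eqxx normr1 expr1n mulr1 addr0.
by move=> i /negPf ik; rewrite mxE ik normr0 expr0n mulr0.
Qed.

(** [Q - Q^*] is normal because it is minus its own adjoint, and its quadratic
    form is [2i] times the imaginary part of that of [Q].  Its eigenvalues, values of
    that form at eigenvectors, are therefore 0. *)
Lemma form_real_hermitian Q :
  (forall v, cdot (Q *m v) v \is Num.real) -> Q \is hermsymmx.
Proof.
move=> Qreal; pose H := Q - Q^t*.
have adjH : H^t* = - H by rewrite /H linearB /= map_mxB trmxCK opprB.
have nH : H \is normalmx by apply/normalmxP; rewrite adjH mulmxN mulNmx.
have d0 : spectral_diag H = 0.
  apply/rowP => k; rewrite -form_spectral_vector // mxE mulmxBl cdotBl.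
  rewrite [X in _ - X]cdot_adj trmxCK [X in _ - X]cdot_conj.
  by rewrite conj_Creal ?subrr.
apply/is_hermitianmxP; rewrite expr0 scale1r; apply/eqP; rewrite -subr_eq0 -/H.
by rewrite [H]spectral_decomposition // d0 linear0 mulmx0 mul0mx.
Qed.

(** In an eigenbasis of [Q], the entry [(i, k)] of the relation [A Q = Q A]
    reads [A i k * (d k - d i) = 0]: column [k] of [A] is supported at [k]. *)
Lemma simple_eigenvector Q k A : Q \is normalmx ->
    (forall i, i != k -> spectral_diag Q 0 i != spectral_diag Q 0 k) ->
    A *m Q = Q *m A ->
  exists lambda, A *m spectral_vector Q k = lambda *: spectral_vector Q k.
Proof.
move=> nQ simple_k AQ; set U := spectralmx Q; set d := spectral_diag Q in simple_k.
have UU : U *m U^t* = 1%:M by apply/unitarymxP/spectral_unitarymx.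
have UU' : U^t* *m U = 1%:M by apply/unitarymx_adj_mul/spectral_unitarymx.
pose B := U *m A *m U^t*.
have BD : B *m diag_mx d = diag_mx d *m B.
  have DE : diag_mx d = U *m Q *m U^t*.
    rewrite [in RHS](spectral_decomposition nQ) !mulmxA UU mul1mx.
    by rewrite -mulmxA UU mulmx1.
  rewrite DE /B -!mulmxA ![U^t* *m (U *m _)]mulmxA UU' !mul1mx.
  by congr (_ *m _); rewrite !mulmxA AQ.
have Bk : B *m delta_mx k (0 : 'I_1) = B k k *: delta_mx k 0.
  apply/colP=> i; rewrite -colE !mxE; have [->|ik] := eqVneq i k.
    by rewrite mulr1.
  rewrite mulr0; have /matrixP/(_ i k) := BD.
  rewrite mul_mx_diag mul_diag_mx !mxE mulrC => /eqP.
  rewrite -subr_eq0 -mulrBl mulf_eq0 subr_eq0 eq_sym (negPf (simple_k _ ik)) /=.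
  by move=> /eqP.
exists (B k k); rewrite /spectral_vector -/U scalemxAr -Bk /B.
by rewrite !mulmxA UU' mul1mx.
Qed.

Lemma common_eigenvector_of_commutant Q xi (t : C) :
    (forall v, 0 <= cdot (Q *m v) v) -> \tr Q = 1 -> cdot xi xi = 1 ->
    0 <= t -> 2 * t < 1 -> 1 - t <= cdot (Q *m xi) xi ->
  exists eta, [/\ cdot eta eta = 1, 1 - 2 * t <= `|cdot xi eta| ^+ 2 &
    forall A, A *m Q = Q *m A -> exists lambda, A *m eta = lambda *: eta].
Proof.
move=> Q_ge0 trQ xi1 t_ge0 t_lt Qxi.
have nQ : Q \is normalmx.
  by apply/hermitian_normalmx/form_real_hermitian => v; rewrite ger0_real.
have uQ := spectral_unitarymx Q.
have d_ge0 i : 0 <= spectral_diag Q 0 i by rewrite -form_spectral_vector.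
have d1 : \sum_i spectral_diag Q 0 i = 1.
  rewrite -mxtrace_diag -trQ [in RHS](spectral_decomposition nQ) -mulmxA.
  by rewrite mxtrace_mulC -mulmxA (unitarymxP uQ) mulmx1.
have c1 : \sum_i `|(spectralmx Q *m xi) i 0| ^+ 2 = 1.
  by rewrite -cdot_normE cdot_adj mulmxA unitarymx_adj_mul // mul1mx.
have c_ge0 i : 0 <= `|(spectralmx Q *m xi) i 0| ^+ 2 by rewrite exprn_ge0.
rewrite form_spectral // in Qxi.
have [k [simple_k ck]] := dominant_weight d_ge0 c_ge0 d1 c1 t_ge0 t_lt Qxi.
exists (spectral_vector Q k); split.
- by rewrite -cdot_adj spectral_vector_coord cdot_delta mxE !eqxx.
- rewrite -cdot_adj cdot_delta -subr_ge0.
  have -> : forall y : C, y - (1 - 2 * t) = 2 * t - (1 - y) by move=> y; ring.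
  by rewrite subr_ge0.
- by move=> A; apply: simple_eigenvector.
Qed.

End SpectralGap.

(** * Approximate fixed points of unitary groups *)

Lemma averaged_projection (R : realType) (n : nat) (G : set 'M[R[i]]_n)
    (xi : 'cV[R[i]]_n) (c : R[i]) :
    matrix_group G -> (forall A, G A -> A \is unitarymx) -> cdot xi xi = 1 ->
    (forall A, G A -> c <= `|cdot (A *m xi) xi| ^+ 2) ->
  exists Q, [/\ forall v, 0 <= cdot (Q *m v) v, \tr Q = 1,
    c <= cdot (Q *m xi) xi & forall A, G A -> A *m Q = Q *m A].
Proof.
move=> groupG unitaryG xi1 cG; have [_ G1 GM _] := groupG.
(* The last condition is imposed on all conjugates to make [S] invariant; each
   condition is an intersection of closed half-spaces. *)
pose S (X : 'M[R[i]]_n) := [/\ forall v, 0 <= cdot (X *m v) v, \tr X = 1 &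
  forall A, G A -> c <= cdot (conjmx_unitary A X *m xi) xi].
have tr_lin : linear_for *%R (@mxtrace R[i] n).
  by move=> a X Y; rewrite linearD linearZ.
have meanS : mean_closed S.
  move=> s s0 Ss; split.
  - move=> v; apply: (mean_closed_linear (@mean_ge _ 0) (form_linear v v)) => //.
    by move=> X /Ss[].
  - apply: (mean_closed_linear (@mean_eq _ 1) tr_lin) => //.
    by move=> X /Ss[].
  - move=> A GA; rewrite form_conjmx_unitary.
    apply: (mean_closed_linear (@mean_ge _ c) (form_linear _ _)) => //.
    by move=> X /Ss[_ _ /(_ A GA)]; rewrite form_conjmx_unitary.
have invS : conj_invariant G S.
  move=> A X GA [X_ge0 trX X_c]; split=> [v||B GB].
  - by rewrite form_conjmx_unitary.
  - by rewrite mxtrace_conjmx_unitary ?unitaryG.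
  - by rewrite conjmx_unitary_comp; apply/X_c/GM.
have SP : S (xi *m xi^t*).
  split=> [v||A GA].
  - by rewrite form_rank1 [cdot v xi]cdot_conj mulrC -normCK exprn_ge0.
  - by rewrite mxtrace_mulC trace_mx11 -cdot_mx.
  - have -> : conjmx_unitary A (xi *m xi^t*) = (A *m xi) *m (A *m xi)^t*.
      by rewrite /conjmx_unitary trmx_mul map_mxM !mulmxA.
    by rewrite form_rank1 [cdot xi _]cdot_conj mulrC -normCK cG.
have [Q [SQ commQ]] := mean_ergodic groupG unitaryG meanS invS SP.
exists Q; split=> //.
- move=> v; apply: (adherent_ge SQ (linear_lipschitz (form_linear v v))).
  by move=> X [].
- apply: (adherent_eq SQ (linear_lipschitz tr_lin)).
  by move=> X [].
- apply: (adherent_ge SQ (linear_lipschitz (form_linear xi xi))) => X [_ _].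
  move=> /(_ _ G1); rewrite form_conjmx_unitary trmx1 map_mx1 mul1mx.
  done.
Qed.

(** The bound is [2 (1 - (1 - 2 t))] with [t = 2 eps]: one factor 2 comes from
    squaring [1 - eps], one from the spectral gap and one from the passage from
    the inner product to the distance. *)
Lemma common_eigenvector_near (R : realType) (n : nat) (eps : R)
    (G : set 'M[R[i]]_n) (xi : 'cV[R[i]]_n) :
    0 <= eps -> 4 * eps < 1 ->
    matrix_group G -> (forall A, G A -> A \is unitarymx) ->
    weak_approx_fixed_point eps G xi ->
  exists eta, common_eigenvector G eta /\ cnorm (xi - eta) ^+ 2 <= (8 * eps)%:C.
Proof.
move=> eps_ge0 eps_lt groupG unitaryG [xi1 xiG].
have {}xi1 : cdot xi xi = 1 by rewrite -cnorm_sqr xi1 expr1n.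
have eps_lt1 : eps < 1 by lra.
have cG A : G A -> 1 - (2 * eps)%:C <= `|cdot (A *m xi) xi| ^+ 2.
  move=> /xiG xiA; apply: le_trans (_ : (1 - eps)%:C ^+ 2 <= _).
    rewrite -rmorphXn -(rmorph1 (real_complex R)) -rmorphB lecR; nra.
  by rewrite lerXn2r // nnegrE ?normr_ge0 // lecR subr_ge0 ltW.
have [Q [Q_ge0 trQ Qxi commQ]] := averaged_projection groupG unitaryG xi1 cG.
have t_ge0 : 0 <= (2 * eps)%:C by rewrite ler0c; lra.
have tE : 2 * (2 * eps)%:C = (4 * eps)%:C.
  by rewrite -[2]/(2%:R) -(rmorph_nat (real_complex R)) -rmorphM; congr _%:C; ring.
have t_lt : 2 * (2 * eps)%:C < 1 by rewrite tE -(rmorph1 (real_complex R)) ltcR.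
have [eta [eta1 xi_eta eigen]] :=
  common_eigenvector_of_commutant Q_ge0 trQ xi1 t_ge0 t_lt Qxi.
have c_bounds : 0 < 1 - 2 * (2 * eps)%:C <= 1.
  by rewrite subr_gt0 t_lt gerBl mulr_ge0.
have [z z1 dist] := phase_alignment xi1 eta1 c_bounds xi_eta.
exists (z *: eta); split; first split.
- by apply: cnorm_eq1; rewrite cdotZl cdotZr mulrA -normCK z1 expr1n mul1r.
- move=> A /commQ/eigen[lambda Aeta]; exists lambda.
  by rewrite -scalemxAr Aeta !scalerA mulrC.
- rewrite cnorm_sqr; apply: le_trans dist _.
  rewrite tE opprB addrC subrK -[2]/(2%:R) -(rmorph_nat (real_complex R)).
  by rewrite -rmorphM lecR; lra.
Qed.

Theorem theorem8p3 (R : realType) (n : nat) (eps : R)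
    (G : set 'M[R[i]]_n) (xi : 'cV[R[i]]_n) :
  (2 <= n)%N ->
  0 < eps -> eps < 1 / (3600 * n%:R ^+ 11) ->
  matrix_group G ->
  (forall A, G A -> A \is unitarymx) ->
  weak_approx_fixed_point eps G xi ->
  exists eta : 'cV[R[i]]_n,
    common_eigenvector G eta /\
    cnorm (xi - eta) ^+ 2 < (3600 * n%:R ^+ 11 * eps)%:C.
Proof.
move=> n_ge2 eps_gt0 eps_lt groupG unitaryG xiG.
have pow_ge1 : 1 <= n%:R ^+ 11 :> R.
  by rewrite exprn_ege1 // ler1n (leq_trans _ n_ge2).
have eps_small : 3600 * n%:R ^+ 11 * eps < 1.
  by move: eps_lt; rewrite ltr_pdivlMr 1?mulrC //; nra.
have [|eta [eigen dist]] :=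
  common_eigenvector_near (ltW eps_gt0) _ groupG unitaryG xiG; first by nra.
exists eta; split=> //; apply: le_lt_trans dist _; rewrite ltcR.
nra.
Qed.
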